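(* Let $d \geq 1$ and let $p_1, \dots, p_d \in [1/2, 1)$, with $q_i = 1 - p_i$, $Q_i = 1/q_i$ and $Q = \prod_{i=1}^d Q_i$. Let $\mu$ be the probability measure on subsets of $[d]$ given by $\mu(\{A\}) = \prod_{i \in A} p_i \prod_{i \notin A} q_i$. Let $\mathcal{F}$ be a union-closed family of subsets of $[d]$ with $\emptyset \in \mathcal{F}$. Then for every hitting set $S$ of $\mathcal{F}$ which is minimal under inclusion, $$\sum_{i \in S} \log Q_i \leq \log\big(Q\, \mu(\mathcal{F})\big).$$
   Context: A family $\mathcal{F}$ of subsets of $[d]=\{1,\dots,d\}$ is union-closed if $A, B \in \mathcal{F}$ implies $A \cup B \in \mathcal{F}$. A hitting set of $\mathcal{F}$ is a set $S \subset [d]$ such that every non-empty $A \in \mathcal{F}$ satisfies $A \cap S \neq \emptyset$; it is minimal if no proper subset of $S$ is a hitting set. For a family $\mathcal{G}$, $\mu(\mathcal{G}) = \sum_{A \in \mathcal{G}} \mu(\{A\})$. The logarithms are to any fixed base greater than $1$. *)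

(* Defs.v *)
From HB Require Import structures.
From mathcomp Require Import all_boot all_order all_algebra.
From mathcomp Require Import reals exp.

Set Implicit Arguments.
Unset Strict Implicit.
Unset Printing Implicit Defensive.

Import Order.TTheory GRing.Theory Num.Theory.
Local Open Scope ring_scope.

Definition union_closed (T : finType) (F : {set {set T}}) : Prop :=
  forall A B : {set T}, A \in F -> B \in F -> A :|: B \in F.

Definition hitting_set (T : finType) (F : {set {set T}}) (S : {set T}) : bool :=
  [forall A in F, (A != set0) ==> (A :&: S != set0)].

Definition product_mass (R : realType) (d : nat) (p : 'I_d -> R)
    (A : {set 'I_d}) : R :=
  (\prod_(i in A) p i) * (\prod_(i in ~: A) (1 - p i)).

Definition product_measure (R : realType) (d : nat) (p : 'I_d -> R)
    (G : {set {set 'I_d}}) : R :=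
  \sum_(A in G) product_mass p A.

Definition logb (R : realType) (b x : R) : R := ln x / ln b.

(* Main.v *)
(** Put r_i = p_i / q_i >= 1, so that Q_i = 1 + r_i and Q mu(A) is the product
    of the r_i over A.  By minimality each i in S has a member of F meeting S
    exactly in i; taking unions, every B <= S is the trace on S of a member of
    F, whose weight is at least that of B.  Hence Q mu(F) is at least the sum
    over B <= S of the weights of B, which is the product of the 1 + r_i over
    S. *)
Require Import Defs.
From HB Require Import structures.
From mathcomp Require Import all_boot all_order all_algebra.
From mathcomp Require Import reals exp.
From mathcomp Require Import ring lra.

Set Implicit Arguments.
Unset Strict Implicit.
Unset Printing Implicit Defensive.

Import Order.TTheory GRing.Theory Num.Theory.
Local Open Scope ring_scope.

(** By minimality [S :\ i] is not hitting, so some nonempty [A] in [F] misses it. As [S] itself hits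
    [A], the two can only meet in [i]. *)
Lemma minset_hitting_trace1 (T : finType) (F : {set {set T}}) (S : {set T})
    (i : T) :
  minset (hitting_set F) S -> i \in S -> exists2 A, A \in F & A :&: S = [set i].
Proof.
move=> /minsetP[/forall_inP hitS minS] iS.
have: ~~ hitting_set F (S :\ i).
  by apply/negP => /minS /(_ (subD1set S i)) /setP/(_ i); rewrite !inE eqxx iS.
case/forall_inPn => A AF; rewrite negb_imply negbK => /andP[A0 /eqP AS0].
exists A => //; have := implyP (hitS A AF) A0.
have AS : A :&: S \subset [set i].
  apply/subsetP => j; rewrite !inE => /andP[jA jS].
  by move/setP/(_ j): AS0; rewrite !inE jA jS !andbT => /negbT; rewrite negbK.
by move: AS; rewrite subset1 => /orP[/eqP-> //|->].
Qed.

Lemma minset_hitting_trace (T : finType) (F : {set {set T}}) (S B : {set T}) :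
  union_closed F -> set0 \in F -> minset (hitting_set F) S -> B \subset S ->
  exists2 A, A \in F & A :&: S = B.
Proof.
move=> ucF F0 minS BS.
(* The largest candidate: the union of all members with trace inside [B]. It cannot leave [B] within
   [S], and the members with singleton traces make it cover [B]. The hypothesis [set0 \in F]
   accounts for an empty union. *)
exists (\bigcup_(A in F | A :&: S \subset B) A).
  by apply: (big_ind [in F]) => [|A A'|A /andP[]]//; apply: ucF.
apply/eqP; rewrite eqEsubset; apply/andP; split.
  apply/subsetP => j; rewrite inE => /andP[/bigcupP[A /andP[_ AB] jA] jS].
  by apply: (subsetP AB); rewrite inE jA.
rewrite subsetI BS andbT; apply/subsetP => i iB.
have [A AF ASi] := minset_hitting_trace1 minS (subsetP BS i iB).
apply/bigcupP; exists A; first by rewrite AF ASi sub1set.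
by have := set11 i; rewrite -ASi inE => /andP[].
Qed.

Lemma prod_addr1_powerset (R : comNzRingType) (T : finType) (r : T -> R)
    (S : {set T}) :
  \prod_(i in S) (r i + 1) = \sum_(B in powerset S) \prod_(i in B) r i.
Proof.
rewrite big_mkcond /=.
under eq_bigr => i _.
  (* Writing a factor outside [S] as [0 + 1] lets the product run over all of [T], where it expands
     over all subsets; those not inside [S] pick up a factor 0. *)
  rewrite (_ : (if _ then _ else _) = (if i \in S then r i else 0) + 1).
    by over.
  by case: ifP; rewrite // add0r.
rewrite bigA_distr [RHS]big_mkcond /=; apply: eq_bigr => B _.
rewrite powersetE; case: ifPn => [/subsetP BS|/subsetPn[i iB iS]].
  rewrite [RHS]big_mkcond; apply: eq_bigr => i _.
  by case: ifP => // /BS ->.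
by rewrite (bigD1 i) //= iB (negbTE iS) mul0r.
Qed.

Lemma prodr_ge1 (R : numDomainType) (I : Type) (s : seq I) (P : pred I)
    (f : I -> R) :
  (forall i, P i -> 1 <= f i) -> 1 <= \prod_(i <- s | P i) f i.
Proof. by move=> f1; apply: (big_ind (>= 1)) => // x y; apply: mulr_ege1. Qed.

(** Group the members of [F] by their trace on [S]. In the class of [B], keep a single member [A]
    and drop the other nonnegative terms. *)
Lemma prod_addr1_le_trace (R : numDomainType) (T : finType) (r : T -> R)
    (F : {set {set T}}) (S : {set T}) :
  (forall i, 1 <= r i) ->
  (forall B : {set T}, B \subset S -> exists2 A, A \in F & A :&: S = B) ->
  \prod_(i in S) (r i + 1) <= \sum_(A in F) \prod_(i in A) r i.
Proof.
move=> r1 trF; have r0 i : 0 <= r i by apply: le_trans (r1 i).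
rewrite prod_addr1_powerset.
rewrite [leRHS](partition_big (fun A => A :&: S) [in powerset S]); last first.
  by move=> A _; rewrite powersetE subsetIr.
apply: ler_sum => B /=; rewrite powersetE => /trF[A AF ASB].
rewrite (bigD1 A) ?AF ?ASB ?eqxx //= -[leLHS]addr0.
apply: lerD; last by apply: sumr_ge0 => C _; apply: prodr_ge0.
(* The weight of [A] is that of [B] times the factors over [A :\: S], each at least 1. *)
rewrite [leRHS](big_setID S) /= ASB ler_peMr ?prodr_ge0 //.
exact: prodr_ge1.
Qed.

(** The inverse of [1 - p i] cancels the factor of the mass for [i] outside [A], and turns [p i]
    into a ratio for [i] in [A]. *)
Lemma prodV_product_mass (R : realType) (d : nat) (p : 'I_d -> R)
    (A : {set 'I_d}) :
  (forall i, p i != 1) ->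
  (\prod_i (1 - p i)^-1) * product_mass p A = \prod_(i in A) (p i / (1 - p i)).
Proof.
move=> p1; have q0 i : 1 - p i != 0 by rewrite subr_eq0 eq_sym.
rewrite /product_mass (bigID [in A]) /= mulrACA -big_split /=.
under [X in _ * (_ * X)]eq_bigl => i do rewrite inE.
rewrite -[X in _ * X]big_split /=.
under [X in _ * X]eq_bigr => i _ do rewrite mulVf //.
by rewrite big1_eq mulr1; apply: eq_bigr => i _; rewrite mulrC.
Qed.

Lemma ln_prod (R : realType) (I : Type) (s : seq I) (P : pred I) (f : I -> R) :
  (forall i, P i -> 0 < f i) ->
  ln (\prod_(i <- s | P i) f i) = \sum_(i <- s | P i) ln (f i).
Proof.
move=> f0; elim: s => [|i s IHs]; first by rewrite !big_nil ln1.
rewrite !big_cons; case: ifP => // Pi.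
by rewrite lnM ?posrE ?IHs ?f0 ?prodr_gt0.
Qed.

Theorem theorem3p2 (R : realType) (b : R) (d : nat) (p q Qi : 'I_d -> R) (Q : R)
    (F : {set {set 'I_d}}) (S : {set 'I_d}) :
  1 < b ->
  (1 <= d)%N ->
  (forall i, 2^-1 <= p i < 1) ->
  (forall i, q i = 1 - p i) ->
  (forall i, Qi i = (q i)^-1) ->
  Q = \prod_i Qi i ->
  union_closed F ->
  set0 \in F ->
  minset (hitting_set F) S ->
  \sum_(i in S) logb b (Qi i) <= logb b (Q * product_measure p F).
Proof.
move=> b1 _ pP qE QiE -> ucF F0 minS.
have p1 i : p i != 1 by rewrite lt_eqF //; case/andP: (pP i).
have q0 i : 0 < 1 - p i by rewrite subr_gt0; case/andP: (pP i).
have Qi0 i : 0 < Qi i by rewrite QiE qE invr_gt0.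
pose r i := p i / (1 - p i).
(* Here the bound [2^-1 <= p i] enters, as [1 - p i <= p i]. *)
have r1 i : 1 <= r i by rewrite ler_pdivlMr // mul1r; case/andP: (pP i); lra.
have QiDr i : Qi i = r i + 1.
  by rewrite QiE qE /r; field; apply: lt0r_neq0.
have massE : (\prod_i Qi i) * product_measure p F
           = \sum_(A in F) \prod_(i in A) r i.
  rewrite /product_measure big_distrr /=; apply: eq_bigr => A _.
  rewrite -prodV_product_mass //; congr (_ * _).
  by apply: eq_bigr => i _; rewrite QiE qE.
have leQ : \prod_(i in S) Qi i <= (\prod_i Qi i) * product_measure p F.
  rewrite massE (eq_bigr _ (fun i _ => QiDr i)).
  by apply: prod_addr1_le_trace => // B; apply: minset_hitting_trace.
have QS0 : 0 < \prod_(i in S) Qi i by apply: prodr_gt0.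
rewrite /logb -mulr_suml -ln_prod // ler_pM2r ?invr_gt0 ?ln_gt0 //.
by rewrite ler_ln ?posrE // (lt_le_trans QS0).
Qed.
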